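(* Let $L$ be a completely distributive lattice which is upper well ordered, let $G$ be a group, and let $\mu\in L(G)$ be a finitely generated $L$-group. Let $\eta\in NL(\mu)$, and suppose that $\eta$, $\Phi(\mu)$ and $\mu$ have the same tips. Then $\eta\subseteq\Phi(\mu)$ if and only if there is no proper $L$-subgroup $\theta$ of $\mu$ such that $\eta\circ\theta=\mu$.
   Context: $L$ is a completely distributive lattice with least element $0$, and $G$ is a group. $L$ is upper well ordered if every non-empty subset of $L$ contains its supremum. An $L$-subset of $G$ is a function $G\to L$; its tip is the supremum of its values; $\eta\subseteq\mu$ means $\eta(x)\le\mu(x)$ for all $x\in G$. An $L$-subgroup of $G$ is an $L$-subset $\mu$ with $\mu(xy)\ge\mu(x)\wedge\mu(y)$ and $\mu(x^{-1})=\mu(x)$ for all $x,y\in G$; $L(G)$ is the set of these. For $\mu\in L(G)$, $L(\mu)$ is the set of $\eta\in L(G)$ with $\eta\subseteq\mu$ (the $L$-subgroups of $\mu$), and $NL(\mu)$ is the set of normal $L$-subgroups of $\mu$, i.e. $\eta\in L(\mu)$ with $\eta(yxy^{-1})\ge\eta(x)\wedge\mu(y)$ for all $x,y\in G$. The set product of $L$-subsets is $(\eta\circ\theta)(x)=\bigvee_{x=yz}\{\eta(y)\wedge\theta(z)\}$. For $a\in L$, $x\in G$, the $L$-point $a_x$ is the $L$-subset with value $a$ at $x$ and $0$ elsewhere; $a_x\in\mu$ means $\mu(x)\ge a$. $\mu$ is finitely generated if there are finitely many $L$-points ${a_1}_{x_1},\dots,{a_n}_{x_n}\in\mu$ such that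 $\mu$ is the smallest $L$-subgroup of $G$ containing their union (pointwise join). $\theta\in L(\mu)$ is a proper $L$-subgroup of $\mu$ if $\theta$ is non-constant and $\theta\ne\mu$. A proper $L$-subgroup $\nu$ of $\mu$ is a maximal $L$-subgroup of $\mu$ if, whenever $\nu\subseteq\theta\subseteq\mu$ with $\theta\in L(\mu)$, either $\theta=\nu$ or $\theta=\mu$. The Frattini $L$-subgroup $\Phi(\mu)$ is the intersection (pointwise meet) of all maximal $L$-subgroups of $\mu$, and $\Phi(\mu)=\mu$ if $\mu$ has no maximal $L$-subgroups. *)

(* Defs.v *)
From HB Require Import structures.
From mathcomp Require Import all_boot all_order.
From mathcomp Require Import boolp classical_sets.

Set Implicit Arguments.
Unset Strict Implicit.
Unset Printing Implicit Defensive.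

Import Order.TTheory.
Local Open Scope classical_set_scope.
Local Open Scope order_scope.

HB.mixin Record isCompleteLattice d L of Order.TBLattice d L := {
  lsup : set L -> L;
  linf : set L -> L;
  lsup_isLub : forall A : set L, isLub A (lsup A);
  linf_lb : forall A : set L, lbound A (linf A);
  linf_glb : forall (A : set L) (b : L), lbound A b -> b <= linf A
}.

#[short(type="completeLatticeType")]
HB.structure Definition CompleteLattice d :=
  { L of Order.TBLattice d L & isCompleteLattice d L }.

(* The meet of the joins of a family J of subsets is the join, over all choice
   functions f for J, of the meets of the values of f. *)
HB.mixin Record isCompletelyDistributive d L of CompleteLattice d L := {
  linf_lsup : forall (I : Type) (J : I -> set L),
    linf [set lsup (J i) | i in [set: I]] =
    lsup [set linf (range f) | f in [set f : I -> L | forall i, J i (f i)]]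
}.

#[short(type="completelyDistrLatticeType")]
HB.structure Definition CompletelyDistrLattice d :=
  { L of CompleteLattice d L & isCompletelyDistributive d L }.

Definition upper_well_ordered d (L : completeLatticeType d) : Prop :=
  forall A : set L, A !=set0 -> A (lsup A).

(* An L-subset of G is a plain function G -> L; inclusion of L-subsets is the
   pointwise order on functions provided by boolp. *)
Section LSubsets.
Context d (L : completeLatticeType d) (G : groupType).
Implicit Types (eta theta mu nu : G -> L).

Definition tip mu : L := lsup (range mu).

Definition lsubgroup mu : Prop :=
  (forall x y : G, mu x `&` mu y <= mu (x * y)%g) /\
  (forall x : G, mu (x^-1)%g = mu x).

Definition lsubgroup_of mu eta : Prop := lsubgroup eta /\ eta <= mu.

Definition normal_lsubgroup_of mu eta : Prop :=
  lsubgroup_of mu eta /\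
  (forall x y : G, eta x `&` mu y <= eta (y * x * y^-1)%g).

Definition set_product eta theta : G -> L := fun x =>
  lsup [set eta p.1 `&` theta p.2 | p in [set p : G * G | x = (p.1 * p.2)%g]].

Definition lpoint (a : L) (x : G) : G -> L :=
  fun y => if y == x then a else \bot.

Definition lpoint_in (a : L) (x : G) mu : Prop := a <= mu x.

Definition is_generated_by eta mu : Prop :=
  [/\ lsubgroup mu, eta <= mu &
      forall nu, lsubgroup nu -> eta <= nu -> mu <= nu].

Definition finitely_generated mu : Prop :=
  exists (n : nat) (a : 'I_n -> L) (x : 'I_n -> G),
    (forall i, lpoint_in (a i) (x i) mu) /\
    is_generated_by (fun y => \join_(i < n) lpoint (a i) (x i) y) mu.

Definition proper_lsubgroup_of mu theta : Prop :=
  [/\ lsubgroup_of mu theta,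
      ~ (exists c : L, forall x, theta x = c) & theta <> mu].

Definition maximal_lsubgroup_of mu nu : Prop :=
  proper_lsubgroup_of mu nu /\
  (forall theta, lsubgroup_of mu theta -> nu <= theta ->
     theta = nu \/ theta = mu).

Definition frattini mu : G -> L :=
  if `[< exists nu, maximal_lsubgroup_of mu nu >]
  then fun x => linf [set nu x | nu in maximal_lsubgroup_of mu]
  else mu.

End LSubsets.

(* Main.v *)
Require Import Defs.
From mathcomp Require Import all_boot all_order.
From mathcomp Require Import boolp classical_sets.

Import Order.TTheory.
Local Open Scope order_scope.

(** Upper well ordering makes every supremum of a non-empty set attained, so a
    value of a set product [eta o theta] at [x] comes from one factorisation of
    [x], and a value of the join of a chain of [L]-subgroups comes from one
    member of the chain.

    Suppose that [eta] lies below every maximal [L]-subgroup and that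
    [eta o theta = mu] with [theta] proper.  The equation forces [theta] to have
    the same value at the identity as [mu].  Since [mu] is finitely generated,
    Zorn's lemma gives an [L]-subgroup [nu] maximal among those that contain
    [theta] and differ from [mu] (lemma [exists_maximal_lsubgroup_ge]); such a
    [nu] is non-constant, because a constant [L]-subgroup with the tip of [mu]
    contains [mu].  Both factors lie in [nu], hence so does [mu], which is
    absurd.

    Conversely, let [nu] be a maximal [L]-subgroup.  As [eta] is normal,
    [eta o nu] is an [L]-subgroup of [mu] (lemma [lsubgroup_set_product]), and
    it contains both [eta] and [nu], because the tip hypotheses make the value
    of either factor at the identity dominate every value of [mu].  Maximality
    leaves [eta o nu = mu], which is excluded, or [eta o nu = nu], which gives
    that [eta] lies in [nu]. *)

(** * Suprema *)

Section CompleteLattices.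
Context {d : Order.disp_t} {L : completeLatticeType d}.

Lemma le_lsup (A : set L) (a : L) : A a -> a <= lsup A.
Proof. by case: (lsup_isLub A) => + _; apply. Qed.

Lemma lsup_le (A : set L) (b : L) : (forall a, A a -> a <= b) -> lsup A <= b.
Proof. by case: (lsup_isLub A) => _; apply. Qed.

End CompleteLattices.

(** * L-subgroups and their products *)

Section LSubgroups.
Context {d : Order.disp_t} {L : completeLatticeType d} {G : groupType}.
Implicit Types (eta theta mu nu : G -> L) (F : set (G -> L)).

Lemma lsubgroup_le_one {mu} : lsubgroup mu -> forall x, mu x <= mu 1%g.
Proof.
by move=> [muM muV] x; have := muM x x^-1%g; rewrite muV meetxx mulgV.
Qed.

Lemma tip_lsubgroup {mu} : lsubgroup mu -> tip mu = mu 1%g.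
Proof.
move=> hmu; apply/le_anti/andP; split; last by apply: le_lsup; exists 1%g.
by apply: lsup_le => _ [x _ <-]; exact: lsubgroup_le_one.
Qed.

Lemma tip_mono {eta mu} : eta <= mu -> tip eta <= tip mu.
Proof.
move=> /lefP le_eta_mu; apply: lsup_le => _ [x _ <-].
by apply: le_trans (le_eta_mu x) _; apply: le_lsup; exists x.
Qed.

Lemma le_set_product eta theta y z :
  eta y `&` theta z <= set_product eta theta (y * z)%g.
Proof. by apply: le_lsup; exists (y, z). Qed.

Lemma set_product_le {eta theta mu} : lsubgroup mu ->
  eta <= mu -> theta <= mu -> set_product eta theta <= mu.
Proof.
move=> [muM _] /lefP le_eta /lefP le_theta; apply/lefP => x.
apply: lsup_le => _ [[y z] /= -> <-].
by apply: le_trans (muM y z); exact: leI2.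
Qed.

Lemma set_product_ge_left eta theta :
  (forall x, eta x <= theta 1%g) -> eta <= set_product eta theta.
Proof.
move=> le1; apply/lefP => x.
by have := le_set_product eta theta x 1%g; rewrite mulg1 (meet_l (le1 x)).
Qed.

Lemma set_product_ge_right eta theta :
  (forall x, theta x <= eta 1%g) -> theta <= set_product eta theta.
Proof.
move=> le1; apply/lefP => x.
by have := le_set_product eta theta 1%g x; rewrite mul1g (meet_r (le1 x)).
Qed.

Lemma set_product_attained (hL : upper_well_ordered L) eta theta x :
  exists y z, x = (y * z)%g /\ set_product eta theta x = eta y `&` theta z.
Proof.
have [|[y z] /= xE prodE] := hL
  [set (eta p.1 `&` theta p.2)%O
     | p in [set p : G * G | x = (p.1 * p.2)%g]]%classic.
  by exists (eta x `&` theta 1%g), (x, 1%g) => //=; rewrite mulg1.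
by exists y, z; split; last exact: esym.
Qed.

(** As for subgroups: [y z y' z' = y (z y' z^-1) (z z')] and
    [(y z)^-1 = (z^-1 y^-1 z) z^-1], where normality of [eta] controls the
    conjugates because the values of [theta] are below those of [mu]. *)
Lemma lsubgroup_set_product (hL : upper_well_ordered L) {mu eta theta} :
  normal_lsubgroup_of mu eta -> lsubgroup_of mu theta ->
  lsubgroup (set_product eta theta).
Proof.
move=> [[[etaM etaV] _] etaJ] [[thetaM thetaV] /lefP le_theta].
have conj_le m y z : m <= eta y -> m <= theta z -> m <= eta (z * y * z^-1)%g.
  move=> m_y m_z; apply: le_trans (etaJ y z).
  by rewrite lexI m_y (le_trans m_z).
have inv_le x : set_product eta theta x <= set_product eta theta x^-1%g.
  have [y [z [-> ->]]] := set_product_attained hL eta theta x.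
  have -> : (y * z)^-1%g = (z^-1 * y^-1 * z^-1^-1 * z^-1)%g.
    by rewrite invgM invgK mulgK.
  apply: le_trans (le_set_product _ _ _ _).
  by rewrite lexI conj_le ?etaV ?thetaV ?leIl ?leIr.
split=> [x x'|x]; last first.
  by apply/le_anti; rewrite inv_le -{2}[x]invgK inv_le.
have [y [z [-> ->]]] := set_product_attained hL eta theta x.
have [y' [z' [-> ->]]] := set_product_attained hL eta theta x'.
have -> : (y * z * (y' * z') = y * (z * y' * z^-1) * (z * z'))%g.
  by rewrite !mulgA mulgVK.
apply: le_trans (le_set_product _ _ _ _).
rewrite meetACA lexI; apply/andP; split; last by rewrite leIxr.
apply: le_trans (etaM _ _); rewrite lexI leIxl ?leIl // conj_le //.
- by rewrite leIxl // leIr.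
- by rewrite leIxr // leIl.
Qed.

(** * Maximal L-subgroups and the Frattini L-subgroup *)

Lemma frattini_le_maximal {mu nu} :
  maximal_lsubgroup_of mu nu -> frattini mu <= nu.
Proof.
move=> max_nu; apply/lefP => x; rewrite /frattini.
case: asboolP => [_|[]]; last by exists nu.
by apply: linf_lb; exists nu.
Qed.

Lemma le_frattini {mu eta} : eta <= mu ->
  (forall nu, maximal_lsubgroup_of mu nu -> eta <= nu) -> eta <= frattini mu.
Proof.
move=> le_mu le_max; rewrite /frattini; case: asboolP => // _.
apply/lefP => x; apply: linf_glb => _ [nu max_nu <-].
by have /lefP := le_max nu max_nu.
Qed.

(** * Existence of maximal L-subgroups *)

(** A value of the join at [x * y] involves two members of the chain, and the
    larger of the two is an [L]-subgroup that carries both values. *)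
Lemma lsubgroup_lsup_chain (hL : upper_well_ordered L) F :
  (F !=set0)%classic -> total_on F (fun nu nu' => nu <= nu') ->
  (forall nu, F nu -> lsubgroup nu) ->
  lsubgroup (fun x => lsup [set nu x | nu in F]%classic).
Proof.
move=> [nu0 Fnu0] totF subF.
have attained x : exists2 nu, F nu & lsup [set nu x | nu in F]%classic = nu x.
  have [|nu Fnu <-] := hL [set nu x | nu in F]%classic; last by exists nu.
  by exists (nu0 x), nu0.
split=> [x y|x]; last first.
  by congr lsup; apply: eq_imagel => nu /subF[].
have [nu Fnu ->] := attained x; have [nu' Fnu' ->] := attained y.
have [nu'' Fnu'' [le_x le_y]] : exists2 nu'', F nu'' &
    nu x <= nu'' x /\ nu' y <= nu'' y.
  have [/lefP le_nu | /lefP le_nu] := totF nu nu' Fnu Fnu'.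
  - by exists nu'.
  - by exists nu.
apply: le_trans (le_lsup _ (nu'' (x * y)%g) _); last by exists nu''.
have [nuM _] := subF nu'' Fnu''.
by apply: le_trans (nuM x y); exact: leI2.
Qed.

(** Totality of the chain merges finitely many witnesses into one. *)
Lemma chain_upper_bound_seq F (s : seq (L * G)) :
  (F !=set0)%classic -> total_on F (fun nu nu' => nu <= nu') ->
  (forall p, p \in s -> exists2 nu, F nu & p.1 <= nu p.2) ->
  exists2 nu, F nu & forall p, p \in s -> p.1 <= nu p.2.
Proof.
move=> [nu0 Fnu0] totF; elim: s => [_|p s IHs in_chain]; first by exists nu0.
have [|nu Fnu le_nu] := IHs.
  by move=> q qs; apply: in_chain; rewrite inE qs orbT.
have [|nu' Fnu' le_nu'] := in_chain p; first by rewrite inE eqxx.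
have [/lefP le | /lefP le] := totF nu nu' Fnu Fnu'.
- exists nu' => // q; rewrite inE => /predU1P[-> //|qs].
  exact: le_trans (le_nu q qs) (le _).
- exists nu => // q; rewrite inE => /predU1P[->|]; last exact: le_nu.
  exact: le_trans le_nu' (le _).
Qed.

(** In this form, finite generation lets a single member of a chain be
    recognised as containing [mu]. *)
Lemma finitely_generated_leP mu : finitely_generated mu ->
  exists s : seq (L * G), forall nu, lsubgroup nu ->
    (mu <= nu <-> forall p, p \in s -> p.1 <= nu p.2).
Proof.
move=> [n [a [x [_ [mu_sub /lefP gen_le mu_least]]]]].
exists [seq (a i, x i) | i <- enum 'I_n] => nu nu_sub; split.
  move=> /lefP le_nu _ /mapP[i _ ->] /=; apply: le_trans (le_nu _).
  apply: le_trans (gen_le _); apply: (joins_min (j := i)) => //.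
  by rewrite /lpoint eqxx.
move=> s_le; apply: mu_least => //; apply/lefP => y; apply/joinsP => i _.
rewrite /lpoint; case: eqP => [->|_]; last exact: le0x.
by apply: (s_le (a i, x i)); apply: map_f; rewrite mem_enum.
Qed.

(** The supremum of a chain of [L]-subgroups is [mu] only if it dominates the
    finitely many generators of [mu]; each generator is then reached by a member
    of the chain, because suprema are attained, and so the largest of these
    members is already [mu].  Zorn's lemma therefore applies to the
    [L]-subgroups between [theta] and [mu] that differ from [mu].  The
    condition on the value at the identity is there because a proper
    [L]-subgroup has to be non-constant. *)
Lemma exists_maximal_lsubgroup_ge (hL : upper_well_ordered L) {mu theta} :
  finitely_generated mu -> lsubgroup_of mu theta -> theta <> mu ->
  theta 1%g = mu 1%g ->
  exists2 nu, maximal_lsubgroup_of mu nu & theta <= nu.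
Proof.
move=> fg_mu theta_sub theta_neq theta1.
have [s mu_leP] := finitely_generated_leP mu fg_mu.
have mu_sub : lsubgroup mu by case: fg_mu => [n [a [x [_ []]]]].
pose P nu := [/\ lsubgroup_of mu nu, theta <= nu & nu <> mu].
pose le_P (nu nu' : {nu | P nu}) := sval nu <= sval nu'.
have [|||A totA|[nu [nu_sub theta_le nu_neq]] nu_max] := Zorn (R := le_P).
- by move=> nu; exact: lexx.
- by move=> nu nu' nu''; exact: le_trans.
- move=> nu nu' le ge; apply: eq_sig_hprop => [?|]; first exact: Prop_irrelevance.
  exact/le_anti/andP.
(* The empty chain is bounded by [theta]. *)
- have [[nu0 Anu0] | A0] := pselect (A !=set0)%classic; last first.
    exists (exist P theta (And3 theta_sub (lexx theta) theta_neq)) => nu Anu.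
    by case: A0; exists nu.
  pose F := [set sval nu | nu in A]%classic.
  have F0 : (F !=set0)%classic by exists (sval nu0), nu0.
  have totF : total_on F (fun nu nu' => nu <= nu').
    by move=> _ _ [nu Anu <-] [nu' Anu' <-]; exact: totA.
  have subF nu : F nu -> P nu by move=> [nu' _ <-]; exact: svalP.
  pose top x := lsup [set nu x | nu in F]%classic.
  have le_top nu : F nu -> nu <= top.
    by move=> Fnu; apply/lefP => x; apply: le_lsup; exists nu.
  have top_sub : lsubgroup top.
    by apply: lsubgroup_lsup_chain => // nu /subF[[]].
  suff Ptop : P top.
    by exists (exist P top Ptop) => nu Anu; apply: le_top; exists nu.
  split.
  + split=> //; apply/lefP => x; apply: lsup_le => _ [nu /subF[[_ +] _ _] <-].
    by move/lefP.
  + have Fnu0 : F (sval nu0) by exists nu0.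
    by have [_ theta_le _] := subF _ Fnu0; apply: le_trans (le_top _ Fnu0).
  (* The generators lie in [top = mu], hence in one member of the chain. *)
  + move=> topE; have [|nu Fnu s_le] := chain_upper_bound_seq F s F0 totF.
      move=> p ps; have [|nu Fnu nuE] := hL [set nu p.2 | nu in F]%classic.
        by case: F0 => nu Fnu; exists (nu p.2), nu.
      exists nu => //; rewrite nuE -/(top _) topE.
      by apply: (mu_leP mu mu_sub).1 (lexx mu) _ ps.
    have [[nu_sub nu_le] _] := subF nu Fnu; apply.
    by apply/le_anti; rewrite nu_le; apply/(mu_leP nu nu_sub).2.
(* A constant [nu] would have the value [mu 1] everywhere. *)
- exists nu => //; split.
    split=> // -[c nuE]; apply: (nu_neq); have [_ nu_le] := nu_sub.
    apply/le_anti; rewrite nu_le; apply/lefP => x.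
    apply: le_trans (lsubgroup_le_one mu_sub x) _.
    by have /lefP/(_ 1%g) := theta_le; rewrite theta1 !nuE.
  move=> nu' nu'_sub nu_le.
  have [->|nu'_neq] := pselect (nu' = mu); first by right.
  left; have Pnu' : P nu' by split=> //; exact: le_trans nu_le.
  by have /(congr1 sval) := nu_max (exist P nu' Pnu') nu_le.
Qed.

End LSubgroups.

Theorem lemma5p9 (d : Order.disp_t) (L : completelyDistrLatticeType d)
    (G : groupType) (mu eta : G -> L)
    (hL : upper_well_ordered L)
    (hmu : lsubgroup mu)
    (hfg : finitely_generated mu)
    (heta : normal_lsubgroup_of mu eta)
    (htip1 : tip eta = tip mu)
    (htip2 : tip (frattini mu) = tip mu) :
  eta <= frattini mu <->
  ~ (exists theta : G -> L,
       proper_lsubgroup_of mu theta /\ set_product eta theta = mu).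
Proof.
have [[eta_sub eta_le] _] := heta.
have eta1 : eta 1%g = mu 1%g by rewrite -!tip_lsubgroup.
have mu_le1 := lsubgroup_le_one hmu.
split=> [eta_le_frattini [theta [[theta_sub _ theta_neq] prodE]]|no_factor].
  have [y [z [_ prod1E]]] := set_product_attained hL eta theta 1%g.
  have theta1 : theta 1%g = mu 1%g.
    have [hth /lefP theta_le] := theta_sub; apply/le_anti; rewrite theta_le /=.
    by rewrite -[in leLHS]prodE prod1E (le_trans (leIr _ _)) ?lsubgroup_le_one.
  have [nu max_nu theta_le] :=
    exists_maximal_lsubgroup_ge hL hfg theta_sub theta_neq theta1.
  have [[[nu_sub nu_le] _ nu_neq] _] := max_nu.
  apply: nu_neq; apply/le_anti; rewrite nu_le /= -[leLHS]prodE.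
  apply: set_product_le => //.
  exact: le_trans eta_le_frattini (frattini_le_maximal max_nu).
apply: le_frattini => // nu max_nu.
have [nu_proper nu_max] := max_nu; have [nu_sub_of _ _] := nu_proper.
have [nu_sub /lefP nu_le] := nu_sub_of.
have mu1_le : mu 1%g <= nu 1%g.
  rewrite -(tip_lsubgroup nu_sub) -(tip_lsubgroup hmu) -htip2.
  exact: tip_mono (frattini_le_maximal max_nu).
have prod_sub : lsubgroup_of mu (set_product eta nu).
  split; first exact: lsubgroup_set_product heta nu_sub_of.
  by apply: set_product_le => //; apply/lefP.
have nu_le_prod : nu <= set_product eta nu.
  apply: set_product_ge_right => x.
  by rewrite eta1 (le_trans (nu_le x)).
have [prodE|prodE] := nu_max _ prod_sub nu_le_prod.
  rewrite -[leRHS]prodE; apply: set_product_ge_left => x.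
  by move/lefP: eta_le => /(_ x) /le_trans -> //; exact: le_trans mu1_le.
by case: no_factor; exists nu.
Qed.
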